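(* For every fixed integer $m\ge 1$ the limit $$\lim_{k\to\infty}\frac{ch(K_{m*k})}{k}$$ exists. Moreover there are absolute constants $c_1,c_2>0$ such that for every $m\ge2$ this limit lies between $c_1\ln m$ and $c_2\ln m$.
   Context: $K_{m*k}$ denotes the complete $k$-partite graph with $k$ color classes, each of size $m$. The choice number $ch(G)$ of a graph $G$ is the smallest integer $s$ such that for every assignment of a list of $s$ colors to each vertex of $G$ there is a proper coloring of $G$ assigning to each vertex a color from its list. *)

(* Defs.v *)
From HB Require Import structures.
From mathcomp Require Import all_boot all_order all_algebra finmap.
From mathcomp Require Import all_classical all_reals all_analysis.

Set Implicit Arguments.
Unset Strict Implicit.
Unset Printing Implicit Defensive.

Record sgraph := SGraph {
  vertex :> finType;
  adj : rel vertex;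
  adj_sym : symmetric adj;
  adj_irrefl : irreflexive adj }.

(* Colors are natural numbers: a list assignment on a finite graph uses only
   finitely many colors, so any infinite set of colors gives the same notion. *)
Definition choosable (G : sgraph) (s : nat) : Prop :=
  forall L : G -> {fset nat}, (forall v, #|` L v|%fset = s) ->
  exists2 c : G -> nat,
    (forall v, c v \in L v) & (forall u v, adj u v -> c u != c v).

Lemma choosable_card (G : sgraph) : choosable G #|G|.
Proof.
move=> L cardL.
have ext (t : seq G) : uniq t -> exists2 c : G -> nat,
    {in t, forall v, c v \in L v} & {in t &, injective c}.
  elim: t => [_|x t IHt /= /andP[xNt Ut]]; first by exists (fun=> 0).
  have [c cL cI] := IHt Ut.
  have [a aL aNt] : exists2 a, a \in L x & a \notin [seq c v | v <- t].
    have [/allP sub|/allPn[a aL aNt]] := boolP (all [in [seq c v | v <- t]] (L x));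
      last by exists a.
    have := uniq_leq_size (fset_uniq (L x)) sub.
    rewrite -/(size _) size_map cardL => le_t.
    have Uxt : uniq (x :: t) by rewrite /= xNt.
    have := max_card [in x :: t].
    by rewrite (card_uniqP Uxt) /= ltnNge le_t.
  have cNa v : v \in t -> c v != a.
    by move=> vt; apply: contraNneq aNt => <-; apply: map_f.
  have tNx v : v \in t -> (v == x) = false.
    by move=> vt; apply: contraNF xNt => /eqP <-.
  exists (fun v => if v == x then a else c v) => [v|u v]; rewrite !inE.
    by case: eqP => [-> //|_] /= /cL.
  case: (eqVneq u x) => [->|_] /=; case: (eqVneq v x) => [->|_] //=.
  - by move=> _ /cNa; rewrite eq_sym => /negbTE h /eqP; rewrite h.
  - by move=> /cNa /negbTE h _ /eqP; rewrite h.
  - by move=> ut vt; apply: cI.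
have [c cL cI] := ext (enum G) (enum_uniq _).
exists c => [v|u v uv]; first by apply: cL; rewrite mem_enum.
apply: contraTneq uv => /cI -> //; rewrite ?mem_enum //.
by rewrite adj_irrefl.
Qed.

Lemma ex_choosable (G : sgraph) : exists s, `[< choosable G s >].
Proof. by exists #|G|; apply/asboolP/choosable_card. Qed.

Definition choice_number (G : sgraph) : nat := ex_minn (ex_choosable G).

(* The vertex (i, j) is the j-th vertex of the i-th color class. *)
Definition multipartite_adj (m k : nat) : rel ('I_k * 'I_m) :=
  fun u v => u.1 != v.1.

Lemma multipartite_adj_sym m k : symmetric (@multipartite_adj m k).
Proof. by move=> u v; rewrite /multipartite_adj eq_sym. Qed.

Lemma multipartite_adj_irrefl m k : irreflexive (@multipartite_adj m k).
Proof. by move=> u; rewrite /multipartite_adj eqxx. Qed.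

Definition complete_multipartite (m k : nat) : sgraph :=
  SGraph (@multipartite_adj_sym m k) (@multipartite_adj_irrefl m k).

Import GRing.Theory.
Local Open Scope ring_scope.

Definition choice_ratio (R : realType) (m : nat) : R^nat :=
  fun k => (choice_number (complete_multipartite m k))%:R / k%:R.

(* Main.v *)
(** Distribute the colors at random among [t] groups of [k] classes each: by a
    Chernoff bound every list keeps enough colors belonging to its own group,
    so [ch (t * k)] is at most about [t * ch k], up to a factor [1 + 2 d]
    where [d] may be of order [k ^ (- 1/4)]. The error factors of repeated
    doubling have a bounded product that tends to [1] with the starting point,
    so [ch k / k] is almost nonincreasing along all sufficiently long jumps
    and converges.

    Upper bound: split the colors among [m] single classes to get
    [ch m <= O(m ln m)] for [k = m], and let the doubling start at [k = m].

    Lower bound: let [d = log_4 m]. The [d]-subsets of a [2d]-set number at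
    most [4 ^ d <= m] and any set that meets all of them has more than [d]
    elements. Replacing each element by about [k / 2] colors gives lists of
    size about [d * k / 2] for which the classes would need more colors than
    there are. *)

Require Import Defs.
From HB Require Import structures.
From mathcomp Require Import all_boot all_order all_algebra finmap.
From mathcomp Require Import all_classical all_reals all_analysis.
Import Order.TTheory GRing.Theory Num.Theory.
Import numFieldNormedType.Exports.
From mathcomp Require Import ring lra zify.
Local Open Scope classical_set_scope.
Local Open Scope ring_scope.

(** * Choosability and the choice number of general graphs *)

Lemma choosable_large {G : sgraph} {s} (L : G -> {fset nat}) :
  choosable G s -> (forall v, s <= #|` L v|%fset)%N ->
  exists2 c : G -> nat,
    (forall v, c v \in L v) & (forall u v, adj u v -> c u != c v).
Proof.
move=> Gs leL.
pose L' v := [fset x in take s (L v)]%fset.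
have [|c cL' c_proper] := Gs L'.
  move=> v; rewrite /L' card_fseq undup_id ?take_uniq ?fset_uniq //.
  by rewrite size_takel.
exists c => // v; move: (cL' v).
by rewrite !inE => /mem_take.
Qed.

Lemma choosable_choice_number (G : sgraph) : choosable G (choice_number G).
Proof. by rewrite /choice_number; case: ex_minnP => s /asboolP. Qed.

Lemma choice_number_le {G : sgraph} {s} :
  choosable G s -> (choice_number G <= s)%N.
Proof.
by move=> Gs; rewrite /choice_number; case: ex_minnP => r _; apply; apply/asboolP.
Qed.

Lemma choice_number_gt {G : sgraph} {s} :
  ~ choosable G s -> (s < choice_number G)%N.
Proof.
move=> nGs; rewrite ltnNge; apply/negP => le_s; apply: nGs => L cL.
by apply: choosable_large (choosable_choice_number G) _ => v; rewrite cL.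
Qed.

(** Lists on [G] are pulled back along [g], and the resulting coloring of [H] is restricted along
    [f]. *)
Lemma choice_number_mono {G H : sgraph} (f : G -> H) (g : H -> G) :
  cancel f g -> (forall u v, adj u v -> adj (f u) (f v)) ->
  (choice_number G <= choice_number H)%N.
Proof.
move=> fK f_adj; apply: choice_number_le => L cL.
have [|c cLg c_proper] := @choosable_choice_number H (L \o g).
  by move=> v /=; rewrite cL.
exists (c \o f) => [v|u v /f_adj /c_proper //].
by have := cLg (f v); rewrite /= fK.
Qed.

(** * Random distribution of colors among groups *)

(* The sum is [t^C] times the expectation of [x] to the number of colors of
   [A] that a uniformly random [g : 'I_C -> 'I_t] sends to [i]. *)
Lemma sum_exp_card_preimage {R : realFieldType} {C t : nat} (A : {set 'I_C})
    (i : 'I_t) (x : R) :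
  \sum_(g : {ffun 'I_C -> 'I_t}) x ^+ #|[set c in A | g c == i]%SET| =
  (x + t.-1%:R) ^+ #|A| * t%:R ^+ (C - #|A|).
Proof.
pose F (c : 'I_C) (j : 'I_t) : R := if (c \in A) && (j == i) then x else 1.
transitivity (\sum_(g : {ffun 'I_C -> 'I_t}) \prod_c F c (g c)).
  apply: eq_bigr => g _; rewrite -big_mkcond /= -prodr_const.
  by apply: eq_bigl => c; rewrite inE.
(* Independence: the sum factors over the colors, with factor [x + (t - 1)] inside [A] and [t]
   outside. *)
rewrite -bigA_distr_bigA /= (bigID (mem A)) /=; congr (_ * _).
  rewrite -prodr_const; apply: eq_bigr => c cA.
  rewrite (bigD1 i) //= /F cA eqxx /=; congr (_ + _).
  rewrite (eq_bigr (fun=> 1)) => [|j /negbTE -> //].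
  by rewrite sumr_const cardC1 card_ord.
have -> : (C - #|A|)%N = #|~: A|%SET by rewrite [RHS]cardsCs finset.setCK card_ord.
rewrite -prodr_const; apply: eq_big => [c|c /negbTE cA]; first by rewrite inE.
by rewrite /F (eq_bigr (fun=> 1)) ?sumr_const ?card_ord // => j; rewrite cA.
Qed.

(** Exponential moments: the hypothesis says that the mean over [g] of the sum of the weights
    [W g v] is below [x ^+ a]. Some [g] does no worse than the mean, and since [x <= 1] a vertex
    keeping fewer than [a] colors would alone weigh at least [x ^+ a]. *)
Lemma exists_balanced_map {R : realFieldType} {V : finType} {C t a s : nat}
    (A : V -> {set 'I_C}) (i : V -> 'I_t) (x : R) :
  (0 < t)%N -> 0 < x <= 1 -> (forall v, #|A v| = s) ->
  #|V|%:R * (1 - (1 - x) / t%:R) ^+ s < x ^+ a ->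
  exists g : {ffun 'I_C -> 'I_t},
    forall v, (a <= #|[set c in A v | g c == i v]%SET|)%N.
Proof.
move=> t0 /andP[x0 x1] cA small.
have tR : 0 < t%:R :> R by rewrite ltr0n.
pose W (g : {ffun 'I_C -> 'I_t}) v := x ^+ #|[set c in A v | g c == i v]%SET|.
have [g gP] : exists g, \sum_v W g v < x ^+ a.
  apply: contrapT => /forallNP big.
  have : x ^+ a *+ (t ^ C) <= \sum_(g : {ffun 'I_C -> 'I_t}) \sum_v W g v.
    rewrite -[in X in X <= _](card_ord C) -[in X in X <= _](card_ord t).
    rewrite -card_ffun -sumr_const; apply: ler_sum => g _.
    by rewrite leNgt; apply/negP/big.
  apply/negP; rewrite -ltNge exchange_big /=.
  rewrite (eq_bigr (fun=> (1 - (1 - x) / t%:R) ^+ s * t%:R ^+ C)) => [|v _].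
    rewrite sumr_const -mulrnAl -[X in X * _]mulr_natl -[X in _ < X]mulr_natr natrX.
    by rewrite ltr_pM2r ?exprn_gt0.
  have sC : (s <= C)%N by rewrite -(cA v) -[X in (_ <= X)%N](card_ord C) max_card.
  rewrite sum_exp_card_preimage cA.
  have <- : t%:R ^+ s * t%:R ^+ (C - s) = t%:R ^+ C :> R.
    by rewrite -exprD subnKC.
  rewrite mulrA.
  congr (_ * _); rewrite -exprMn; congr (_ ^+ _).
  by rewrite -subn1 natrB //; field; rewrite gt_eqF.
exists g => v; rewrite leqNgt; apply/negP => lt_a.
move: gP; apply/negP; rewrite -leNgt (bigD1 v) //= ler_wpDr //.
  by apply: sumr_ge0 => w _; rewrite exprn_ge0 // ltW.
by apply: ler_wiXn2l (ltnW lt_a) => //; apply: ltW.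
Qed.

(* Colors are distributed at random among [t] groups of vertices. If every
   vertex keeps [a] colors belonging to its own group, then the groups can be
   colored independently. *)
Lemma choosable_split {R : realFieldType} {G H : sgraph} {t : nat}
    (p : G -> 'I_t) (q : G -> H) {a s : nat} (x : R) :
  (forall u v, p u = p v -> q u = q v -> u = v) ->
  (forall u v, p u = p v -> adj u v -> adj (q u) (q v)) ->
  choosable H a -> (0 < t)%N -> 0 < x <= 1 ->
  #|G|%:R * (1 - (1 - x) / t%:R) ^+ s < x ^+ a -> choosable G s.
Proof.
move=> pq_inj q_adj Ha t0 x01 small L cL.
(* A strict bound on all colors, so that lists become subsets of ['I_C]. *)
pose C := (\max_v \max_(c <- L v) c).+1.
have LC v c : c \in L v -> (c < C)%N.
  move=> cLv; rewrite ltnS (leq_trans _ (leq_bigmax v)) //.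
  exact: (leq_bigmax_seq (F := id)).
pose A v := [set c : 'I_C | val c \in L v]%SET.
have cA v : #|A v| = s.
  rewrite -(cL v) cardE -(size_map val); apply/perm_size/uniq_perm => //.
  - by rewrite map_inj_uniq ?enum_uniq //; apply: val_inj.
  - exact: fset_uniq.
  move=> c; apply/mapP/idP => [[d]|cLv]; first by rewrite mem_enum inE => ? ->.
  by exists (Ordinal (LC _ _ cLv)); rewrite ?mem_enum ?inE.
have [g gP] := exists_balanced_map A p x t0 x01 cA small.
have colorable (i : 'I_t) : exists c : H -> nat,
    (forall v, p v = i -> exists2 d : 'I_C, d \in A v & c (q v) = d /\ g d = i) /\
    (forall u v, adj u v -> c u != c v).
  pose K v := [set c in A v | g c == i]%SET.
  (* Vertices of [H] outside the image of group [i] receive a dummy list of size [a]. *)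
  pose LK w : {fset nat} :=
    if [pick v | (p v == i) && (q v == w)] is Some v
    then [fset (val d : nat) | d in K v]%fset else [fset val d | d : 'I_a in 'I_a]%fset.
  have [w|c cLK c_proper] := choosable_large LK Ha.
    rewrite /LK; case: pickP => [v /andP[/eqP pv _]|_].
      by rewrite card_imfset /= -?cardE /K -?pv ?gP //; apply: val_inj.
    by rewrite card_imfset /= -?cardE ?card_ord //; apply: val_inj.
  exists c; split=> // v pv; have := cLK (q v); rewrite /LK.
  case: pickP => [u /andP[/eqP pu /eqP qu]|/(_ v)]; last by rewrite pv !eqxx.
  have -> : u = v by apply: pq_inj; rewrite ?pu ?pv.
  move=> /imfsetP[d /=]; rewrite inE => /andP[dA /eqP gd] ->.
  by exists d.
have [c cP] := choice colorable.
exists (fun v => c (p v) (q v)) => [v|u v uv].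
  have [d + [-> _]] := (cP (p v)).1 v erefl.
  by rewrite inE.
have [puv|/eqP] := eqVneq (p u) (p v).
  by rewrite puv; apply: (cP _).2; apply: q_adj.
(* Vertices of different groups have colors with different images under [g]. *)
have [d _ [-> <-]] := (cP (p u)).1 u erefl.
have [d' _ [-> <-]] := (cP (p v)).1 v erefl.
by apply: contra_notN => /eqP/val_inj ->.
Qed.

(** * Basic bounds for complete multipartite graphs *)

Local Notation ch m k := (choice_number (complete_multipartite m k)).

(** Class [i] is put at position [i %% k] of group [i %/ k], and the weight is [x = (1 + z)^-1]. The
    inequalities [1 - u <= expR (- u)] and [1 + z <= expR z] then give the condition its exponential
    form. *)
Lemma ch_split {R : realType} {m t k n s : nat} (z : R) :
  (0 < k)%N -> (n <= t * k)%N -> 0 < z ->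
  (n * m)%:R < expR (z * (s%:R / ((1 + z) * t%:R) - (ch m k)%:R)) ->
  (ch m n <= s)%N.
Proof.
move=> k0 n_tk z0 small; apply: choice_number_le.
have [->|n0] := posnP n.
  by move=> L _; exists (fun=> 0%N) => [[[]]|[[]]].
have t0 : (0 < t)%N by move: (leq_trans n0 n_tk); rewrite muln_gt0 => /andP[].
have p_lt (i : 'I_n) : (i %/ k < t)%N by rewrite ltn_divLR // (leq_trans _ n_tk).
have q_lt (i : 'I_n) : (i %% k < k)%N by rewrite ltn_pmod.
pose p (u : complete_multipartite m n) := Ordinal (p_lt u.1).
pose q (u : complete_multipartite m n) : complete_multipartite m k :=
  (Ordinal (q_lt u.1), u.2).
have p_q (u v : complete_multipartite m n) : p u = p v -> (q u).1 = (q v).1 -> u.1 = v.1.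
  case=> puv [] quv; apply: val_inj => /=.
  by rewrite (divn_eq u.1 k) puv quv -divn_eq.
have y0 : 0 < z / (1 + z) by rewrite divr_gt0 ?addr_gt0.
have y1 : z / (1 + z) < 1 by rewrite ltr_pdivrMr ?addr_gt0 // mul1r ltrDr.
have tR : 1 <= t%:R :> R by rewrite ler1n.
apply: (@choosable_split R _ (complete_multipartite m k) t p q (ch m k) s (1 + z)^-1).
- move=> [i j] [i' j'] puv quv; have /= -> := p_q _ _ puv (congr1 fst quv).
  by case: quv => _ ->.
- move=> u v puv; apply: contra => /eqP quv; apply/eqP/p_q => //.
- exact: choosable_choice_number.
- exact: t0.
- by rewrite invr_gt0 addr_gt0 //= invf_le1 ?addr_gt0 // lerDl ltW.
have -> : 1 - (1 + z)^-1 = z / (1 + z) by field; rewrite gt_eqF // addr_gt0.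
rewrite card_prod !card_ord.
have le1 : (1 - z / (1 + z) / t%:R) ^+ s <= expR (- (z * (s%:R / ((1 + z) * t%:R)))).
  have -> : - (z * (s%:R / ((1 + z) * t%:R))) = - (z / (1 + z) / t%:R) * s%:R.
    by field; rewrite !gt_eqF ?addr_gt0 //; lra.
  rewrite expRM_natr lerXn2r ?nnegrE ?expR_ge0 ?expR_ge1Dx //.
  rewrite subr_ge0 ler_pdivrMr ?(lt_le_trans _ tR) // mul1r.
  exact: le_trans (ltW y1) tR.
have le2 : expR (- (z * (ch m k)%:R)) <= (1 + z)^-1 ^+ ch m k.
  rewrite expRN exprVn lef_pV2 ?posrE ?exprn_gt0 ?expR_gt0 ?addr_gt0 //.
  by rewrite expRM_natr lerXn2r ?nnegrE ?expR_ge0 ?expR_ge1Dx ?addr_ge0 ?ltW.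
apply: le_lt_trans (ler_wpM2l _ le1) _; first by rewrite ler0n.
apply: lt_le_trans le2.
by rewrite expRN -ltr_pdivlMr ?invr_gt0 ?expR_gt0 // invrK -expRD addrC -mulrBr.
Qed.

Lemma ch_one m : (ch m 1 <= 1)%N.
Proof.
apply: choice_number_le => L cL.
have cP v : exists c, c \in L v.
  by apply/fset0Pn; rewrite -cardfs_gt0 cL.
have [c cLv] := choice cP.
exists c => // u v; rewrite /adj /= /multipartite_adj.
by rewrite (ord1 u.1) (ord1 v.1) eqxx.
Qed.

(** When all lists are equal, one vertex from each class gives a clique of [k] vertices needing
    distinct colors. *)
Lemma ch_ge m k : (0 < m)%N -> (k <= ch m k)%N.
Proof.
case: m => // m _.
have /(_ (fun=> [fset val d | d : 'I_(ch m.+1 k) in 'I_(ch m.+1 k)]%fset)) :=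
  choosable_choice_number (complete_multipartite m.+1 k).
case=> [v|c cL c_proper].
  by rewrite card_imfset /= -?cardE ?card_ord //; apply: val_inj.
have c_lt i : (c (i, ord0) < ch m.+1 k)%N.
  by have /imfsetP[d _ ->] := cL (i, ord0); apply: ltn_ord.
have /leq_card : injective (fun i => Ordinal (c_lt i)).
  move=> i j [] /eqP cij; apply/eqP; apply: contraTT cij => ij.
  exact: c_proper.
by rewrite !card_ord.
Qed.

Lemma ch_mono_size m m' k : (0 < m <= m')%N -> (ch m k <= ch m' k)%N.
Proof.
case: m => // m /= le_m.
pose f (u : complete_multipartite m.+1 k) : complete_multipartite m' k :=
  (u.1, widen_ord le_m u.2).
pose g (u : complete_multipartite m' k) : complete_multipartite m.+1 k :=
  (u.1, inord u.2).
apply: (choice_number_mono f g) => // -[i j]; rewrite /f /g /=.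
by congr pair; apply: inord_val.
Qed.

(* The lists of each class are the [d]-subsets of a [2d]-set, every element of
   which is replaced by [b] colors. The colors used on one class then meet more
   than [d] of the [2d] blocks, whence [k * d.+1 <= 2d * b]. *)
Lemma ch_gt m k d b : ('C(d.*2, d) <= m)%N -> (d.*2 * b < k * d.+1)%N ->
  (d * b < ch m k)%N.
Proof.
move=> le_m lt_b; apply: choice_number_gt => Gs; move: lt_b; apply/negP.
rewrite -leqNgt.
pose F := enum [set B : {set 'I_(d.*2)} | #|B| == d]%SET.
have size_F : size F = 'C(d.*2, d) by rewrite -cardE card_draws card_ord.
have F0 : (0 < size F)%N by rewrite size_F bin_gt0 -addnn leq_addr.
(* The default value makes [S j] a [d]-subset also for [j] beyond the number of [d]-subsets. *)
pose S (j : 'I_m) := nth (head finset.set0 F) F j.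
have S_F j : S j \in F.
  rewrite /S; have [/mem_nth -> //|le_j] := ltnP j (size F).
  by rewrite nth_default //; case: (F) F0 => // x l _; rewrite inE eqxx.
have cS j : #|S j| = d by have := S_F j; rewrite mem_enum inE => /eqP.
pose P j := finset.setX (S j) [set: 'I_b]%SET.
have [v|c cL c_proper] := Gs (fun v =>
  [fset choice.pickle x | x : 'I_d.*2 * 'I_b in P v.2]%fset).
  by rewrite card_imfset /= -?cardE ?cardsX ?cS ?cardsT ?card_ord //.
pose T (i : 'I_k) := [set x : 'I_(d.*2) * 'I_b |
  [exists j, c (i, j) == choice.pickle x]]%SET.
(* [T i] holds the colors used on class [i]. If they met at most [d] blocks, some [d]-subset [B]
   would avoid all of these blocks; but [B] gives the list of a vertex of the class, whose color
   lies in a block of [B]. *)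
have T_big i : (d < #|T i|)%N.
  apply: leq_trans (leq_imset_card fst (T i)).
  rewrite ltnNge; apply/negP => le_d.
  pose U := ~: [set x.1 | x in T i]%SET.
  have dU : (d <= #|U|)%N.
    rewrite cardsCs finset.setCK [#|'I__|]card_ord.
    by move: #|_| le_d => n; lia.
  have [B BU /eqP cB] : exists2 B : {set 'I_(d.*2)}, B \subset U & #|B| == d.
    have : [set B : {set 'I_d.*2} | B \subset U & #|B| == d]%SET != finset.set0.
      by rewrite -card_gt0 cards_draws bin_gt0.
    by case/set0Pn => B; rewrite inE => /andP[]; exists B.
  have BF : B \in F by rewrite mem_enum inE cB.
  have lt_B : (index B F < m)%N by rewrite (leq_trans _ le_m) // -size_F index_mem.
  have /imfsetP[x /=] := cL (i, Ordinal lt_B).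
  rewrite inE /= finset.in_setT andbT /S nth_index // => /(fintype.subsetP BU) + cx.
  rewrite inE => /imsetP[]; exists x => //; rewrite inE.
  by apply/existsP; exists (Ordinal lt_B); rewrite cx.
have TP x i : x \in T i -> exists j, c (i, j) = choice.pickle x.
  by rewrite inE => /existsP[j /eqP cj]; exists j.
have T_disj x : (\sum_(i < k) (x \in T i) <= 1)%N.
  rewrite -big_mkcond sum1_card; apply/card_le1_eqP => i i'.
  move=> /TP[j cj] /TP[j' cj'].
  have [//|ii'] := eqVneq i i'.
  by have := c_proper (i, j) (i', j') ii'; rewrite cj cj' eqxx.
have : (\sum_(i < k) #|T i| <= d.*2 * b)%N.
  rewrite (eq_bigr (fun i => \sum_x (x \in T i : nat))) => [|i _]; last first.
    by rewrite -sum1_card big_mkcond.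
  have -> : (d.*2 * b)%N = (\sum_(x : 'I_(d.*2) * 'I_b) 1)%N.
    by rewrite sum1_card card_prod !card_ord.
  by rewrite exchange_big; apply: leq_sum.
apply: leq_trans.
have -> : (k * d.+1)%N = (\sum_(i < k) d.+1)%N by rewrite sum_nat_const card_ord.
exact: leq_sum.
Qed.

(** * Relative errors under splitting and repeated doubling *)

(** Of the slack [2 * d], one [d] pays for truncating the list size to an integer, since
    [t * ch m k * d >= 1]; the other one feeds the exponent of [ch_split], taken at [z = d / 2]. *)
Lemma ch_step {R : realType} {m t k n : nat} (d : R) :
  (0 < m)%N -> (0 < k)%N -> (0 < t)%N -> (n <= t * k)%N -> 0 < d <= 1 ->
  1 <= k%:R * d -> (n * m)%:R < expR (k%:R * d ^+ 2 / 8) ->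
  (ch m n)%:R <= t%:R * (ch m k)%:R * (1 + 2 * d).
Proof.
move=> m0 k0 t0 n_tk /andP[d0 d1] kd small.
set a : R := (ch m k)%:R.
have ka : k%:R <= a by rewrite ler_nat ch_ge.
have tR : 1 <= t%:R :> R by rewrite ler1n.
have kR : 1 <= k%:R :> R by rewrite ler1n.
have kd_ad : k%:R * d <= a * d by rewrite ler_wpM2r // ltW.
have ta : 1 <= t%:R * (a * d).
  by nra.
pose y : R := t%:R * a * (1 + 2 * d).
have y0 : 0 <= y by rewrite !mulr_ge0 //; lra.
have /andP[le_y y_lt] := truncn_itv y0.
apply: le_trans le_y; rewrite ler_nat.
apply: (@ch_split R _ t k _ _ (d / 2)) => //; first by rewrite divr_gt0.
apply: (lt_le_trans small); rewrite ler_expR -/a.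
set s : R := (Num.truncn y)%:R in y_lt *.
have s_ge : t%:R * a * (1 + d) <= s.
  by move: y_lt; rewrite -natr1 -/s /y; nra.
have s_ge' : a * (1 + d) / (1 + d / 2) <= s / ((1 + d / 2) * t%:R).
  have zt0 : 0 < (1 + d / 2) * t%:R by rewrite mulr_gt0 //; lra.
  rewrite ler_pdivlMr //.
  suff -> : a * (1 + d) / (1 + d / 2) * ((1 + d / 2) * t%:R) = t%:R * a * (1 + d).
    by [].
  by field; lra.
have -> : k%:R * d ^+ 2 / 8 = d / 2 * (k%:R * d / 4) by field.
rewrite ler_pM2l ?divr_gt0 //; apply: le_trans (lerB s_ge' (lexx a)).
have -> : a * (1 + d) / (1 + d / 2) - a = a * d / (2 + d) by field; lra.
have d2 : 0 < 2 + d by lra.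
rewrite ler_pdivlMr //.
by nra.
Qed.

(** Since [x >= 8], each factor [9 / 8] adds at least 1 to the exponent, and [expR 1 >= 2]. This
    keeps the Chernoff condition true while the number of vertices doubles. *)
Lemma exp2_mul_expR_le {R : realType} (x : R) j :
  8 <= x -> 2 ^+ j * expR x <= expR (x * (9 / 8) ^+ j).
Proof.
move=> x8; elim: j => [|j IHj]; first by rewrite !expr0 mul1r mulr1.
have r1 : 1 <= (9 / 8 : R) ^+ j by rewrite exprn_ege1 //; lra.
rewrite exprS -mulrA.
apply: (@le_trans _ _ (expR 1 * expR (x * (9 / 8) ^+ j))).
  by apply: ler_pM => //; rewrite ?mulr_ge0 ?expR_ge0 // (le_trans _ (expR_ge1Dx 1)).
rewrite -expRD ler_expR exprS; set r := (9 / 8) ^+ j in r1 *; nra.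
Qed.

(* Step [j] allows the relative error [d * (3 / 4) ^ j]: the errors are summable,
   while the Chernoff exponent still grows, by a factor [2 * (3 / 4) ^ 2 = 9 / 8]
   per step. *)
Lemma ch_double {R : realType} {m k : nat} (d : R) j :
  (0 < m)%N -> (0 < k)%N -> 0 < d <= 1 -> 8 <= k%:R * d ^+ 2 / 8 ->
  (2 * k * m)%:R < expR (k%:R * d ^+ 2 / 8) ->
  (ch m (2 ^ j * k))%:R <=
    2 ^+ j * (ch m k)%:R * expR (8 * d * (1 - (3 / 4) ^+ j)).
Proof.
move=> m0 k0 /andP[d0 d1] x8 small; elim: j => [|j IHj].
  by rewrite expn0 mul1n !expr0 mul1r subrr mulr0 expR0 mulr1.
have q0 : 0 < (3 / 4 : R) ^+ j by rewrite exprn_gt0 //; lra.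
have q1 : (3 / 4 : R) ^+ j <= 1 by rewrite exprn_ile1 //; lra.
pose d' := d * (3 / 4) ^+ j.
have kd : 1 <= k%:R * d.
  have : k%:R * d ^+ 2 <= k%:R * d by rewrite ler_wpM2l //; nra.
  by lra.
have h1 : (ch m (2 ^ j.+1 * k))%:R <= 2%:R * (ch m (2 ^ j * k))%:R * (1 + 2 * d').
  apply: ch_step => //.
  - by rewrite muln_gt0 expn_gt0.
  - by rewrite expnS mulnA.
  - by rewrite mulr_gt0 //= /d'; nra.
  - have -> : (2 ^ j * k)%:R * d' = (3 / 2) ^+ j * (k%:R * d).
      have -> : (3 / 2) ^+ j = 2 ^+ j * (3 / 4) ^+ j :> R.
        by rewrite -exprMn; congr (_ ^+ _); field.
      by rewrite natrM natrX /d'; ring.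
    have q32 : 1 <= (3 / 2 : R) ^+ j by rewrite exprn_ege1 //; lra.
    by nra.
  have -> : (2 ^ j * k)%:R * d' ^+ 2 / 8 = k%:R * d ^+ 2 / 8 * (9 / 8) ^+ j.
    have -> : (9 / 8) ^+ j = 2 ^+ j * (3 / 4) ^+ j ^+ 2 :> R.
      by rewrite exprAC -exprMn; congr (_ ^+ _); field.
    by rewrite natrM natrX /d'; field.
  apply: lt_le_trans (exp2_mul_expR_le _ j x8).
  have -> : (2 ^ j.+1 * k * m)%:R = 2 ^+ j * (2 * k * m)%:R :> R.
    by rewrite expnS !natrM natrX; ring.
  by rewrite ltr_pM2l ?exprn_gt0.
apply: le_trans h1 _.
(* The exponent is the geometric sum of the errors [2 * d * (3 / 4) ^+ i] over the steps [i] made so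
   far. *)
have -> : 8 * d * (1 - (3 / 4) ^+ j.+1) = 8 * d * (1 - (3 / 4) ^+ j) + 2 * d'.
  by rewrite exprS /d'; field.
rewrite expRD exprS.
have := expR_ge1Dx (2 * d').
set e := expR (2 * d'); set f := expR _ in IHj *.
move=> le_e.
apply: (@le_trans _ _ (2 * (2 ^+ j * (ch m k)%:R * f) * e)).
  rewrite ler_pM ?mulr_ge0 // ?ler_wpM2l //.
  by rewrite addr_ge0 // /d' !mulr_ge0 //; apply: ltW.
by rewrite le_eqVlt; apply/orP; left; apply/eqP; ring.
Qed.

(** Doubling leads from [k] to [k' = 2 ^ j * k] with [T * k' <= n < 2 * T * k']; a last split into
    [t = n %/ k' + 1] groups reaches [n]. As [T * d >= 1], rounding up to [t * k'] costs at most a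
    factor [1 + d]. *)
Lemma choice_ratio_le {R : realType} {m k n T : nat} (d : R) :
  (0 < m)%N -> (0 < k)%N -> 0 < d <= 1 -> 1 <= T%:R * d ->
  8 <= k%:R * d ^+ 2 / 8 ->
  (2 * T * k * m)%:R < expR (k%:R * d ^+ 2 / 8) -> (T * k <= n)%N ->
  choice_ratio R m n <= expR (11 * d) * choice_ratio R m k.
Proof.
move=> m0 k0 d01 Td x8 small n_ge; have /andP[d0 d1] := d01.
have T0 : (0 < T)%N.
  by rewrite lt0n; apply: contraTneq Td => ->; rewrite mul0r -ltNge.
have Tk0 : (0 < T * k)%N by rewrite muln_gt0 T0.
have n0 : (0 < n)%N := leq_trans Tk0 n_ge.
have q0 : (0 < n %/ (T * k))%N by rewrite divn_gt0.
set j := trunc_log 2 (n %/ (T * k)).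
have /andP[j_le j_lt] := trunc_log_bounds (isT : 1 < 2)%N q0.
rewrite -/j leq_divRL // in j_le; rewrite -/j ltn_divLR // in j_lt.
pose k' := (2 ^ j * k)%N.
have k'0 : (0 < k')%N by rewrite muln_gt0 expn_gt0.
have Tk' : (T * k' <= n)%N by rewrite /k' mulnCA.
have n_lt : (n < 2 * T * k')%N by move: j_lt; rewrite expnS /k'; nia.
pose t := (n %/ k').+1.
have n_tk' : (n <= t * k')%N by rewrite ltnW // ltn_ceil.
have tk'_n : (t * k' <= n + k')%N.
  by rewrite /t mulSn addnC leq_add2r leq_divM.
have h8 : 1 <= (9 / 8 : R) ^+ j by rewrite exprn_ege1 //; lra.
have r2 : (9 / 8 : R) ^+ j <= 2 ^+ j by rewrite lerXn2r ?nnegrE //; lra.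
have p1 : 1 <= (2 : R) ^+ j by rewrite exprn_ege1 //; lra.
have k'R : k'%:R = 2 ^+ j * k%:R :> R by rewrite /k' natrM natrX.
have kd : 1 <= k%:R * d.
  have : k%:R * d ^+ 2 <= k%:R * d by rewrite ler_wpM2l //; nra.
  by lra.
have step : (ch m n)%:R <= t%:R * (ch m k')%:R * (1 + 2 * d).
  apply: ch_step => //; first by rewrite k'R; nra.
  have : (n * m)%:R <= 2 ^+ j * (2 * T * k * m)%:R :> R.
    rewrite -natrX -natrM ler_nat.
    have -> : (2 ^ j * (2 * T * k * m) = 2 * T * k' * m)%N by rewrite /k'; ring.
    by rewrite leq_mul2r (ltnW n_lt) orbT.
  move=> /le_lt_trans; apply.
  apply: (@lt_le_trans _ _ (2 ^+ j * expR (k%:R * d ^+ 2 / 8))).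
    by rewrite ltr_pM2l ?exprn_gt0.
  apply: le_trans (exp2_mul_expR_le _ j x8) _.
  rewrite ler_expR k'R.
  have -> : 2 ^+ j * k%:R * d ^+ 2 / 8 = k%:R * d ^+ 2 / 8 * 2 ^+ j by ring.
  by rewrite ler_wpM2l //; lra.
have small2 : (2 * k * m)%:R < expR (k%:R * d ^+ 2 / 8).
  by apply: le_lt_trans small; rewrite ler_nat !leq_mul // leq_pmulr.
have chain := ch_double d j m0 k0 d01 x8 small2.
have chain' : (ch m k')%:R <= 2 ^+ j * (ch m k)%:R * expR (8 * d).
  apply: le_trans chain _; rewrite ler_wpM2l ?mulr_ge0 ?exprn_ge0 // ler_expR.
  have : 0 <= (3 / 4 : R) ^+ j by rewrite exprn_ge0 //; lra.
  by nra.
have nR : 0 < n%:R :> R by rewrite ltr0n.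
have tn : t%:R * k'%:R <= n%:R * (1 + d).
  rewrite -natrM; apply: le_trans (_ : (n + k')%:R <= _).
    by rewrite ler_nat.
  have : T%:R * k'%:R <= n%:R :> R by rewrite -natrM ler_nat.
  have : 0 <= k'%:R :> R by [].
  by rewrite natrD; nra.
rewrite /choice_ratio ler_pdivrMr //.
have kR : 0 < k%:R :> R by rewrite ltr0n.
have a0 : 0 <= (ch m k)%:R / k%:R :> R by rewrite divr_ge0.
have e8 := expR_ge0 (8 * d).
(* The three terms pay for the doublings, the last split and the rounding. *)
have -> : 11 * d = 8 * d + 2 * d + d by ring.
rewrite !expRD.
have e2 := expR_ge1Dx (2 * d); have e1 := expR_ge1Dx d.
apply: le_trans step _.
apply: (@le_trans _ _
  (n%:R * (1 + d) * ((ch m k)%:R / k%:R * expR (8 * d)) * (1 + 2 * d))).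
  apply: ler_wpM2r; first lra.
  apply: (@le_trans _ _ (t%:R * (2 ^+ j * (ch m k)%:R * expR (8 * d)))).
    by rewrite ler_wpM2l.
  have -> : t%:R * (2 ^+ j * (ch m k)%:R * expR (8 * d)) =
      t%:R * k'%:R * ((ch m k)%:R / k%:R * expR (8 * d)) :> R.
    by rewrite k'R; field; rewrite gt_eqF.
  by rewrite ler_wpM2r // mulr_ge0.
have -> : n%:R * (1 + d) * ((ch m k)%:R / k%:R * expR (8 * d)) * (1 + 2 * d) =
  ((1 + d) * (1 + 2 * d)) * (n%:R * ((ch m k)%:R / k%:R * expR (8 * d))) by ring.
have -> : expR (8 * d) * expR (2 * d) * expR d * ((ch m k)%:R / k%:R) * n%:R =
  (expR d * expR (2 * d)) * (n%:R * ((ch m k)%:R / k%:R * expR (8 * d))) by ring.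
apply: ler_wpM2r; first by rewrite !mulr_ge0.
by apply: ler_pM => //; lra.
Qed.

(** * Existence of the limit *)

Lemma linear_lt_expR {R : realType} (A B c : R) :
  0 < c -> exists K, forall k, (K <= k)%N -> A * k%:R < expR (c * k%:R) /\ B <= c * k%:R.
Proof.
move=> c0; pose M := `|2 * A / c ^+ 2| + `|B / c|.
exists (Num.truncn M).+1 => k le_k.
have Mk : M < k%:R.
  by apply: lt_le_trans (truncnS_gt M) _; rewrite ler_nat.
have kA : 2 * A <= c ^+ 2 * k%:R.
  rewrite -ler_pdivrMl ?exprn_gt0 // mulrC (le_trans (ler_norm _)) //.
  by rewrite (le_trans _ (ltW Mk)) // lerDl.
have kB : B <= c * k%:R.
  rewrite -ler_pdivrMl // mulrC (le_trans (ler_norm _)) //.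
  by rewrite (le_trans _ (ltW Mk)) // lerDr.
split=> //.
have ck : 0 <= c * k%:R by rewrite mulr_ge0 // ltW.
have := expR_ge1Dxn 1 ck; rewrite (_ : 2`!%:R = 2 :> R) //.
have : 2 * A * k%:R <= c ^+ 2 * k%:R * k%:R by rewrite ler_wpM2r.
by lra.
Qed.

(** The limit is the upper limit [l], the infimum of the eventual upper bounds. For large [k] the
    number [(1 + e) * h k] is itself such a bound, so [h k] cannot be far below [l]. *)
Lemma cvgn_of_eventually_le {R : realType} (h : R^nat) :
  (forall n, 0 <= h n) ->
  (forall e, 0 < e -> \forall k \near \oo, \forall n \near \oo,
    h n <= (1 + e) * h k) -> cvgn h.
Proof.
move=> h0 hP.
pose S := [set x | \forall n \near \oo, h n <= x].
have S_ge x : S x -> 0 <= x.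
  by case=> N _ /(_ N (leqnn N)); apply: le_trans.
have S_inf : has_inf S.
  split; last by exists 0 => x /S_ge.
  have [K _ /(_ K (leqnn K))] := hP 1 ltr01.
  by exists ((1 + 1) * h K).
set l := inf S.
have l0 : 0 <= l by apply: lb_le_inf => //; case: S_inf.
apply/cvg_ex; exists l; apply/cvgrPdist_le => e e0.
have [x Sx x_lt] := inf_adherent e0 S_inf.
(* Chosen so that [e' * l <= e]; adding 1 covers the case [l = 0]. *)
pose e' := e / (l + 1).
have e'0 : 0 < e' by rewrite divr_gt0 // ltr_wpDl.
near=> k.
have hk : h k <= x by near: k; exact: Sx.
have lk : l <= (1 + e') * h k.
  apply: ge_inf; first by case: S_inf.
  by near: k; exact: hP.
rewrite ler_distlC; apply/andP; split; last by apply: (le_trans hk); rewrite ltW.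
rewrite lerBlDl.
have [lt_l|ge_l] := ltP l (h k); first by rewrite (le_trans (ltW lt_l)) // lerDr ltW.
apply: (le_trans lk); rewrite mulrDl mul1r addrC lerD2r.
apply: (@le_trans _ _ (e' * l)); first by rewrite ler_wpM2l // ltW.
rewrite /e' mulrAC ler_pdivrMr ?ltr_wpDl // ler_wpM2l ?ltW //; lra.
Unshelve. all: end_near.
Qed.

Lemma choice_ratio_eventually_le {R : realType} m (d : R) :
  (0 < m)%N -> 0 < d <= 1 -> \forall k \near \oo, \forall n \near \oo,
    choice_ratio R m n <= expR (11 * d) * choice_ratio R m k.
Proof.
move=> m0 d01; have /andP[d0 d1] := d01.
pose T := (Num.truncn d^-1).+1.
have Td : 1 <= T%:R * d.
  by rewrite -ler_pdivrMr // mul1r ltW // truncnS_gt.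
have c0 : 0 < d ^+ 2 / 8 by rewrite divr_gt0 ?exprn_gt0.
have [K KP] := linear_lt_expR (2 * T * m)%:R 8 _ c0.
exists K.+1 => // k /= lt_k; have [lt_e le_8] := KP k (ltnW lt_k).
have cE : d ^+ 2 / 8 * k%:R = k%:R * d ^+ 2 / 8 by ring.
rewrite cE in lt_e le_8.
exists (T * k)%N => // n /= le_n.
apply: (@choice_ratio_le R m k n T) => //; first exact: leq_ltn_trans lt_k.
by move: lt_e; rewrite -natrM mulnAC.
Qed.

Lemma choice_ratio_cvgn {R : realType} m : (0 < m)%N -> cvgn (choice_ratio R m).
Proof.
move=> m0; apply: cvgn_of_eventually_le => [n|e e0].
  by rewrite /choice_ratio divr_ge0.
(* This makes [expR (11 * d) <= 1 + e]. *)
pose d := Num.min 1 (ln (1 + e) / 11).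
have lne : 0 < ln (1 + e) by rewrite ln_gt0 // ltrDl.
have d01 : 0 < d <= 1.
  by rewrite /d lt_min ltr01 divr_gt0 //= ge_min lexx.
have de : expR (11 * d) <= 1 + e.
  rewrite -[leRHS]lnK ?posrE ?addr_gt0 // ler_expR mulrC -ler_pdivlMr //.
  by rewrite /d ge_min lexx orbT.
near=> k.
have : \forall n \near \oo, choice_ratio R m n <= expR (11 * d) * choice_ratio R m k.
  by near: k; exact: choice_ratio_eventually_le.
apply: filterS => n /le_trans; apply.
by rewrite ler_wpM2r // /choice_ratio divr_ge0.
Unshelve. all: end_near.
Qed.

(** * Logarithmic bounds on the limit *)

Lemma choice_ratio_lim_mono {R : realType} m m' : (0 < m <= m')%N ->
  limn (choice_ratio R m) <= limn (choice_ratio R m').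
Proof.
move=> mm'; have /andP[m0 le_m] := mm'.
apply: ler_lim; [exact: choice_ratio_cvgn| |].
  exact: choice_ratio_cvgn (leq_trans m0 le_m).
by near=> k; rewrite /choice_ratio ler_wpM2r ?invr_ge0 // ler_nat ch_mono_size.
Unshelve. all: end_near.
Qed.

(** The [m] classes form [m] groups of one class each, and [ch m 1 <= 1]. With [z = 1], a list size
    [s > y] makes the exponent [s / (2 * m) - 1] exceed [2 * ln m], the logarithm of the number of
    vertices. *)
Lemma choice_ratio_diag_le {R : realType} m :
  (0 < m)%N -> choice_ratio R m m <= 4 * ln m%:R + 3.
Proof.
move=> m0; have mR : 1 <= m%:R :> R by rewrite ler1n.
have ln0 : 0 <= ln m%:R :> R by rewrite ln_ge0.
pose y : R := 2 * m%:R * (1 + 2 * ln m%:R).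
have y0 : 0 <= y by rewrite !mulr_ge0 //; lra.
have /andP[le_y y_lt] := truncn_itv y0.
rewrite /choice_ratio ler_pdivrMr ?ltr0n //.
apply: (@le_trans _ _ (Num.truncn y).+1%:R); last first.
  by rewrite -natr1; move: le_y; rewrite {2}/y; nra.
rewrite ler_nat; apply: (@ch_split R _ m 1 _ _ 1) => //; first by rewrite muln1.
have -> : (m * m)%:R = expR (2 * ln m%:R) :> R.
  by rewrite natrM -expr2 -[X in X ^+ 2]lnK ?posrE ?ltr0n // -expRM_natl.
rewrite ltr_expR mul1r.
have c1 : (ch m 1)%:R <= 1 :> R by rewrite lern1 ch_one.
apply: lt_le_trans (lerB (lexx _) c1).
by rewrite ltrBrDr ltr_pdivlMr; [move: y_lt; rewrite /y; lra|nra].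
Qed.

(** Comparison with the ratio at [k = m], with [d = 1] and [T = 1]. Large [m] is required for
    [2 * m ^ 2 < expR (m / 8)], obtained from [2 * m < expR (m / 16)]. *)
Lemma choice_ratio_lim_le {R : realType} : exists2 M, (0 < M)%N &
  forall m, (M <= m)%N ->
    limn (choice_ratio R m) <= expR 11 * (4 * ln m%:R + 3).
Proof.
have c0 : 0 < 16^-1 :> R by [].
have [K KP] := linear_lt_expR 2 64 _ c0.
exists K.+1 => // m lt_m; have m0 : (0 < m)%N by exact: leq_trans lt_m.
have [lt_e le_8] := KP m (ltnW lt_m).
apply: (@le_trans _ _ (expR (11 * 1) * choice_ratio R m m)); last first.
  by rewrite mulr1 ler_wpM2l ?expR_ge0 // choice_ratio_diag_le.
apply: limr_le; first exact: choice_ratio_cvgn.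
exists m => // n /= le_n.
apply: (@choice_ratio_le R m m n 1) => //; rewrite ?ltr01 ?lexx ?mulr1 ?mul1n //.
  by rewrite expr1n mulr1; move: le_8; lra.
rewrite expr1n mulr1 muln1.
have -> : m%:R / 8 = 16^-1 * m%:R + 16^-1 * m%:R :> R by field.
rewrite expRD natrM natrM.
have : 0 <= m%:R :> R by [].
by nra.
Qed.

Lemma bin_le_exp2 n k : ('C(n, k) <= 2 ^ n)%N.
Proof.
rewrite -[n in (_ <= 2 ^ n)%N]card_ord -cardsT -card_powerset -[n in 'C(n, _)]card_ord.
by rewrite -card_draws subset_leq_card //; apply/fintype.subsetP => A _;
  rewrite powersetE finset.subsetT.
Qed.

Lemma choice_ratio_lim_ge {R : realType} m : (2 <= m)%N ->
  (4 * ln 4)^-1 * ln m%:R <= limn (choice_ratio R m).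
Proof.
move=> m2; have m0 : (0 < m)%N by exact: leq_trans m2.
have /= /andP[D_le D_lt] := trunc_log_bounds (isT : 1 < 4)%N m0.
set D := trunc_log 4 m in D_le D_lt.
have ln4 : 0 < ln 4 :> R by rewrite ln_gt0 // ltr1n.
have lnm : ln m%:R <= D.+1%:R * ln 4 :> R.
  rewrite mulr_natl -lnXn // ler_ln ?posrE ?exprn_gt0 ?ltr0n // -natrX ler_nat.
  exact: ltnW.
apply: limr_ge; first exact: choice_ratio_cvgn.
exists D.+1 => // k /= lt_k.
have k0 : (0 < k)%N by exact: leq_trans lt_k.
have le4 : (k * D.+1 <= 4 * ch m k)%N.
  have ck := ch_ge m k m0.
  (* For [m < 4] the exponent [D] is 0 and the bound [k <= ch m k] suffices. *)
  have [->|D0] := posnP D; first by rewrite muln1; lia.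
  have : (D * k./2 < ch m k)%N.
    apply: ch_gt.
      by apply: leq_trans (bin_le_exp2 _ _) _; rewrite -mul2n expnM.
    by have := odd_double_half k; nia.
  by have := odd_double_half k; nia.
apply: (@le_trans _ _ (D.+1%:R / 4)).
  rewrite mulrC ler_pdivrMr ?mulr_gt0 //.
  by rewrite (_ : _ / 4 * _ = D.+1%:R * ln 4) //; field.
rewrite /choice_ratio ler_pdivlMr ?ltr0n // mulrAC ler_pdivrMr //.
by rewrite -!natrM ler_nat mulnC [leqRHS]mulnC.
Qed.

Theorem theorem3p2 (R : realType) :
  (forall m : nat, (1 <= m)%N -> cvgn (choice_ratio R m)) /\
  (exists c1 c2 : R, [/\ 0 < c1, 0 < c2 &
     forall m : nat, (2 <= m)%N ->
       c1 * ln m%:R <= limn (choice_ratio R m) <= c2 * ln m%:R]).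
Proof.
split; first exact: choice_ratio_cvgn.
have [M M0 MP] := @choice_ratio_lim_le R.
have ln2 : 0 < ln 2 :> R by rewrite ln_gt0 // ltr1n.
have lnM0 : 0 <= ln M%:R :> R by rewrite ln_ge0 // ler1n.
(* The second summand absorbs the additive constant [4 * ln M + 3], because [ln m >= ln 2]. *)
pose c : R := 4 + (4 * ln M%:R + 3) / ln 2.
have c0 : 0 < c by rewrite ltr_wpDr // divr_ge0 ?ltW //; lra.
exists (4 * ln 4)^-1, (expR 11 * c); split.
- by rewrite invr_gt0 mulr_gt0 // ln_gt0 // ltr1n.
- by rewrite mulr_gt0 ?expR_gt0.
move=> m m2; rewrite choice_ratio_lim_ge //=.
have m0 : (0 < m)%N by exact: leq_trans m2.
(* Passing to class size [m * M >= M] brings small [m] into the range of the upper bound. *)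
apply: (@le_trans _ _ (limn (choice_ratio R (m * M)))).
  by rewrite choice_ratio_lim_mono // m0 leq_pmulr.
apply: le_trans (MP _ (leq_pmull M m0)) _.
rewrite -mulrA ler_wpM2l ?expR_ge0 // natrM lnM ?posrE ?ltr0n //.
have le2 : ln 2 <= ln m%:R :> R by rewrite ler_ln ?posrE ?ltr0n // ler_nat.
have : 4 * ln M%:R + 3 <= (4 * ln M%:R + 3) / ln 2 * ln m%:R :> R.
  by rewrite mulrAC ler_pdivlMr //; apply: ler_wpM2l => //; lra.
by rewrite /c mulrDl; lra.
Qed.
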